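(* Let $s \in \mathbb{C}$. Then $$\zeta(s) = \sum_{n=1}^{\infty} \frac{1}{n^{s}} = \left(\frac{C_0}{1}\right)^{s} + \sum_{n=1}^{\infty} \left(\frac{C_n}{\binom{2n}{n}}\right)^{s},$$ where $C_0 = 1$ is defined as the Catalan number for $n = 0$.
   Context: $\zeta$ is the Riemann zeta function. For positive integers $n$, $C_n = \frac{1}{n+1}\binom{2n}{n}$ is the $n$-th Catalan number, and $\binom{2n}{n}$ is the central binomial coefficient.
   Formalization: The equality with ζ(s) is stated only for Re s > 1, since the series diverges for all other s (at s = 0, ζ(0) = −1/2 but the series is 1+1+…); for every complex s the two series are shown to converge simultaneously with equal sums. *)

(* Defs.v *)
From Stdlib Require Import Reals ClassicalEpsilon.
From Coquelicot Require Import Coquelicot.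
Open Scope R_scope.

Definition Cexp (z : C) : C :=
  (exp (Re z) * cos (Im z), exp (Re z) * sin (Im z)).

(* Principal power x^s = exp (s ln x); only meaningful for 0 < x. *)
Definition Rcpow (x : R) (s : C) : C := Cexp (s * RtoC (ln x))%C.

(* [Binomial.C] is the real-valued binomial coefficient; [C] alone denotes
   Coquelicot's complex numbers. *)
Definition central_binom (n : nat) : R := Binomial.C (2 * n) n.

Definition catalan (n : nat) : R :=
  match n with
  | O => 1
  | S _ => / INR (n + 1) * central_binom n
  end.

(* Series are indexed from 0, so the n-th term here is the (n+1)-st term of a
   sum starting at n = 1. *)
Definition dirichlet_term (s : C) (n : nat) : C :=
  (1 / Rcpow (INR (S n)) s)%C.

Definition catalan_term (s : C) (n : nat) : C :=
  Rcpow (catalan (S n) / central_binom (S n)) s.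

Definition half_plane (s : C) : Prop := 1 < Re s.

Definition path_connected (U : C -> Prop) : Prop :=
  forall a b : C, U a -> U b ->
    exists gamma : R -> C,
      (forall t : R, continuous gamma t) /\
      gamma 0 = a /\ gamma 1 = b /\
      (forall t : R, 0 <= t <= 1 -> U (gamma t)).

Definition holomorphic_on (U : C -> Prop) (f : C -> C) : Prop :=
  forall z : C, U z -> ex_derive f z.

(* v is the value at s of the analytic continuation of sum_(n >= 1) 1 / n^s
   from the half-plane Re > 1 to some domain U containing s.  Such a v is unique
   by the identity theorem; it exists exactly for s <> 1, taking for U the
   plane minus the point 1. *)
Definition is_zeta_value (s v : C) : Prop :=
  exists (U : C -> Prop) (f : C -> C),
    open U /\ path_connected U /\ U s /\
    (forall z : C, half_plane z -> U z) /\
    holomorphic_on U f /\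
    (forall z : C, half_plane z -> is_series (dirichlet_term z) (f z)) /\
    f s = v.

(* The Riemann zeta function on the plane minus 1; its value at the pole 1 is
   arbitrary. *)
Definition zeta (s : C) : C :=
  epsilon (inhabits (RtoC 0)) (is_zeta_value s).

(* Main.v *)
(** Since [C_n / binom (2 n) n = 1 / (n + 1)], the Catalan series is the Dirichlet
    series without its first term.  As [zeta] is defined through analytic
    continuation, one also needs the Dirichlet series to be holomorphic on
    [Re s > 1]: the second-order Taylor remainder of [s |-> n^-s] is at most
    [K |h|^2 n^-(1+d)] for [|h| <= d = (Re s - 1) / 4], which is summable in [n]. *)

Require Import Defs.
From Stdlib Require Import Reals.
From Coquelicot Require Import Coquelicot.
From Stdlib Require Import Lra Lia ClassicalEpsilon.
Open Scope R_scope.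

(** * Algebra and modulus of the complex exponential *)

Lemma Cexp_plus (z w : C) : Cexp (z + w) = (Cexp z * Cexp w)%C.
Proof.
  destruct z as [x y], w as [u v]; unfold Cexp, Cplus, Cmult; simpl.
  rewrite exp_plus, cos_plus, sin_plus; f_equal; ring.
Qed.

Lemma Cexp_0 : Cexp 0 = RtoC 1.
Proof.
  unfold Cexp, RtoC; simpl.
  rewrite exp_0, cos_0, sin_0; f_equal; ring.
Qed.

Lemma Cexp_nonzero (z : C) : Cexp z <> RtoC 0.
Proof.
  intro E; pose proof (Cexp_plus z (- z)) as H.
  rewrite Cplus_opp_r, Cexp_0, E, Cmult_0_l in H.
  now apply C1_nz.
Qed.

Lemma Cexp_opp (z : C) : Cexp (- z) = (/ Cexp z)%C.
Proof.
  assert (H : (Cexp (- z) * Cexp z)%C = RtoC 1)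
    by now rewrite <- Cexp_plus, Cplus_comm, Cplus_opp_r, Cexp_0.
  rewrite <- (Cmult_1_l (/ Cexp z)%C), <- H.
  field; apply Cexp_nonzero.
Qed.

Lemma Cmod_Cexp (z : C) : Cmod (Cexp z) = exp (Re z).
Proof.
  unfold Cexp, Cmod; simpl fst; simpl snd.
  replace ((exp (Re z) * cos (Im z)) ^ 2 + (exp (Re z) * sin (Im z)) ^ 2)
    with ((exp (Re z))² * ((sin (Im z))² + (cos (Im z))²)) by (unfold Rsqr; ring).
  rewrite sin2_cos2, Rmult_1_r.
  apply sqrt_Rsqr, Rlt_le, exp_pos.
Qed.

(** * Taylor remainder bounds for sine, cosine and the exponential *)

Lemma Cmod_le_Re_Im (z : C) : Cmod z <= Rabs (Re z) + Rabs (Im z).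
Proof.
  replace z with (RtoC (Re z) + Ci * RtoC (Im z))%C at 1
    by (destruct z; unfold RtoC, Ci, Cplus, Cmult; simpl; f_equal; ring).
  eapply Rle_trans; [apply Cmod_triangle|].
  rewrite Cmod_mult, Cmod_Ci, !Cmod_R; lra.
Qed.

Lemma Im_le_Cmod (z : C) : Rabs (Im z) <= Cmod z.
Proof.
  eapply Rle_trans; [apply Rmax_r | apply Rmax_Cmod].
Qed.

Lemma Rabs_sin_le (y : R) : Rabs (sin y) <= Rabs y.
Proof.
  destruct (MVT_gen sin 0 y cos) as [c [_ E]].
  - intros x _; auto_derive; [easy|ring].
  - intros x _; apply continuity_sin.
  - rewrite sin_0, !Rminus_0_r in E; rewrite E, Rabs_mult.
    assert (Rabs (cos c) <= 1) by (apply Rabs_le, COS_bound).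
    pose proof (Rabs_pos y); nra.
Qed.

Lemma cos_sub_1_bound (y : R) : Rabs (cos y - 1) <= y ^ 2.
Proof.
  (* The half-angle formula turns [cos y - 1] into [- 2 * sin (y / 2) ^ 2], which is controlled by
     [Rabs_sin_le]. *)
  replace y with (2 * (y / 2)) at 1 by field.
  rewrite cos_2a_sin.
  replace (1 - 2 * sin (y / 2) * sin (y / 2) - 1)
    with (- (2 * (sin (y / 2))²)) by (unfold Rsqr; ring).
  pose proof (Rsqr_le_abs_1 _ _ (Rabs_sin_le (y / 2))) as H.
  rewrite Rabs_Ropp, Rabs_pos_eq by (pose proof (Rle_0_sqr (sin (y / 2))); lra).
  unfold Rsqr in *; nra.
Qed.

(** For [Rabs y >= 1] the crude bound [2 * Rabs y] is enough. Otherwise the mean value theorem gives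
    a cubic bound, which is below the quadratic one. *)
Lemma sin_sub_id_bound (y : R) : Rabs (sin y - y) <= 2 * y ^ 2.
Proof.
  destruct (Rle_lt_dec 1 (Rabs y)) as [Hy|Hy].
  - rewrite <- pow2_abs.
    pose proof (Rabs_sin_le y).
    pose proof (Rabs_triang (sin y) (- y)); rewrite Rabs_Ropp in *.
    unfold Rminus; nra.
  - destruct (MVT_gen (fun x => sin x - x) 0 y (fun x => cos x - 1)) as [c [Hc E]].
    + intros x _; auto_derive; [easy|ring].
    + intros x _; apply continuity_pt_minus; [apply continuity_sin|].
      apply derivable_continuous_pt, derivable_pt_id.
    + rewrite sin_0, !Rminus_0_r in E; rewrite E, Rabs_mult.
      pose proof (cos_sub_1_bound c).
      assert (Rabs c <= Rabs y).
      { revert Hc; unfold Rmin, Rmax, Rabs.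
        repeat destruct Rle_dec; repeat destruct Rcase_abs; lra. }
      rewrite <- pow2_abs in H; rewrite <- (pow2_abs y).
      pose proof (Rabs_pos c); pose proof (Rabs_pos y); nra.
Qed.

(** Multiply [1 - x <= exp (- x)] by [exp x]. *)
Lemma exp_sub_1_le (x : R) : exp x - 1 <= x * exp x.
Proof.
  pose proof (exp_ineq1_le (- x)); pose proof (exp_pos x).
  rewrite exp_Ropp in *.
  assert (exp x * (1 + - x) <= exp x * / exp x) by nra.
  rewrite Rinv_r in * by lra; lra.
Qed.

Lemma exp_sub_1_bound (x : R) : Rabs (exp x - 1) <= Rabs x * exp (Rabs x).
Proof.
  pose proof (exp_ineq1_le x).
  pose proof (exp_sub_1_le x).
  unfold Rabs at 2 3; destruct Rcase_abs.
  - pose proof (exp_pos x); pose proof (exp_ineq1_le (- x)).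
    apply Rabs_le; nra.
  - apply Rabs_le; lra.
Qed.

(** The quantity is nonnegative and, by [exp_sub_1_le], at most [x * (exp x - 1)]; the first-order
    bound then supplies the second factor of [Rabs x]. *)
Lemma exp_sub_1_sub_id_bound (x : R) :
  Rabs (exp x - 1 - x) <= x ^ 2 * exp (Rabs x).
Proof.
  pose proof (exp_ineq1_le x).
  rewrite Rabs_pos_eq by lra.
  pose proof (exp_sub_1_le x).
  pose proof (exp_sub_1_bound x).
  assert (x * (exp x - 1) <= Rabs x * Rabs (exp x - 1))
    by (rewrite <- Rabs_mult; apply Rle_abs).
  rewrite <- pow2_abs.
  pose proof (Rabs_pos x); nra.
Qed.

(** Real and imaginary parts are regrouped into the one-variable remainders. The real part
    contributes 2 to the constant and the imaginary part 3. *)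
Lemma Cexp_taylor1_bound (u : C) :
  Cmod (Cexp u - 1 - u) <= 5 * Cmod u ^ 2 * exp (Cmod u).
Proof.
  pose proof (re_le_Cmod u) as Hx; pose proof (Im_le_Cmod u) as Hy.
  eapply Rle_trans; [apply Cmod_le_Re_Im|].
  destruct u as [x y]; unfold Cexp; cbn [Re Im fst snd Cminus Cplus Copp RtoC] in *.
  set (m := Cmod (x, y)) in *.
  assert (Hx2 : x ^ 2 <= m ^ 2)
    by (rewrite <- pow2_abs; apply pow_incr; split; [apply Rabs_pos | lra]).
  assert (Hy2 : y ^ 2 <= m ^ 2)
    by (rewrite <- pow2_abs; apply pow_incr; split; [apply Rabs_pos | lra]).
  assert (Hem : exp (Rabs x) <= exp m)
    by (destruct Hx as [Hx| ->]; [left; now apply exp_increasing | lra]).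
  assert (Hex : exp x <= exp (Rabs x)).
  { destruct (Rle_abs x) as [Hl|He];
      [left; now apply exp_increasing | now rewrite <- He; right]. }
  pose proof (exp_pos x); pose proof (Rabs_pos x); pose proof (Rabs_pos y).
  pose proof (pow2_ge_0 x); pose proof (pow2_ge_0 y).
  replace (exp x * cos y + - (1) + - x)
    with ((exp x - 1 - x) + exp x * (cos y - 1)) by ring.
  replace (exp x * sin y + - 0 + - y)
    with (exp x * (sin y - y) + y * (exp x - 1)) by ring.
  assert (A : Rabs ((exp x - 1 - x) + exp x * (cos y - 1)) <= 2 * (m ^ 2 * exp m)).
  { eapply Rle_trans; [apply Rabs_triang|].
    rewrite Rabs_mult, (Rabs_pos_eq (exp x)) by lra.
    pose proof (exp_sub_1_sub_id_bound x); pose proof (cos_sub_1_bound y).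
    pose proof (Rabs_pos (cos y - 1)).
    assert (x ^ 2 * exp (Rabs x) <= m ^ 2 * exp m) by (apply Rmult_le_compat; lra).
    assert (exp x * Rabs (cos y - 1) <= exp m * m ^ 2) by (apply Rmult_le_compat; lra).
    lra. }
  assert (B : Rabs (exp x * (sin y - y) + y * (exp x - 1)) <= 3 * (m ^ 2 * exp m)).
  { eapply Rle_trans; [apply Rabs_triang|].
    rewrite !Rabs_mult, (Rabs_pos_eq (exp x)) by lra.
    pose proof (exp_sub_1_bound x); pose proof (sin_sub_id_bound y).
    pose proof (Rabs_pos (sin y - y)); pose proof (Rabs_pos (exp x - 1)).
    assert (exp x * Rabs (sin y - y) <= exp m * (2 * m ^ 2)) by (apply Rmult_le_compat; lra).
    assert (Rabs x * exp (Rabs x) <= m * exp m)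
      by (apply Rmult_le_compat; pose proof (exp_pos (Rabs x)); lra).
    assert (Rabs y * Rabs (exp x - 1) <= m * (m * exp m)) by (apply Rmult_le_compat; lra).
    lra. }
  lra.
Qed.

(** * Size and summability of the Dirichlet terms *)

Lemma dirichlet_term_Cexp (s : C) (n : nat) :
  dirichlet_term s n = Cexp (- (s * RtoC (ln (INR (S n))))).
Proof.
  unfold dirichlet_term, Rcpow; rewrite Cexp_opp.
  unfold Cdiv; apply Cmult_1_l.
Qed.

Lemma ln_INR_S_nonneg (n : nat) : 0 <= ln (INR (S n)).
Proof.
  rewrite <- ln_1.
  destruct n; [simpl; lra|].
  left; apply ln_increasing; [lra|].
  apply (lt_INR 1); lia.
Qed.

Lemma Cmod_dirichlet_term (s : C) (n : nat) :
  Cmod (dirichlet_term s n) = exp (- Re s * ln (INR (S n))).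
Proof.
  rewrite dirichlet_term_Cexp, Cmod_Cexp; f_equal.
  destruct s; simpl; ring.
Qed.

(* Telescoping: since [ln (1 - x) <= - x],
   [n^-d - (n+1)^-d >= d (n+1)^-(1+d)]. *)
Lemma ex_series_inv_power (d : R) :
  0 < d -> ex_series (fun n => exp (- (1 + d) * ln (INR (S n)))).
Proof.
  intro Hd.
  set (L := fun n => ln (INR (S n))).
  assert (step : forall n, exp (- (1 + d) * L (S n))
      <= / d * (exp (- d * L n) - exp (- d * L (S n)))).
  { intro n; unfold L.
    set (N := INR (S (S n))).
    assert (HN : INR (S n) = N - 1) by (unfold N; rewrite (S_INR (S n)); ring).
    assert (Hn : 0 < INR (S n)) by (apply lt_0_INR; lia).
    rewrite HN in *.
    (* This is [1 + t <= exp t] at [t = ln ((N - 1) / N)]. *)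
    assert (H1 : / N <= ln N - ln (N - 1)).
    { pose proof (exp_ineq1_le (ln (N - 1) + - ln N)) as E.
      rewrite exp_plus, exp_Ropp, !exp_ln in E by lra.
      replace ((N - 1) * / N) with (1 - / N) in E by (field; lra).
      lra. }
    replace (- (1 + d) * ln N) with (- d * ln N + - ln N) by ring.
    rewrite exp_plus, exp_Ropp, exp_ln by lra.
    replace (- d * ln (N - 1)) with (- d * ln N + d * (ln N - ln (N - 1))) by ring.
    rewrite exp_plus.
    pose proof (exp_ineq1_le (d * (ln N - ln (N - 1)))) as H2.
    assert (H3 : d * / N <= exp (d * (ln N - ln (N - 1))) - 1) by nra.
    pose proof (exp_pos (- d * ln N)) as H4.
    replace (exp (- d * ln N) * / N)
      with (/ d * (exp (- d * ln N) * (d * / N))) by (field; lra).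
    apply Rmult_le_compat_l; [left; now apply Rinv_0_lt_compat|].
    nra. }
  (* [step] only bounds terms of index at least 1, so the term of index 0 is split off. *)
  apply ex_series_incr_1.
  assert (bound : forall n,
      sum_n (fun k => exp (- (1 + d) * L (S k))) n
      <= / d * (1 - exp (- d * L (S n)))).
  { induction n as [|n IH].
    - rewrite sum_O; eapply Rle_trans; [apply step|].
      unfold L at 1; simpl INR; rewrite ln_1, Rmult_0_r, exp_0; lra.
    - rewrite sum_Sn.
      eapply Rle_trans; [apply Rplus_le_compat; [apply IH | apply step]|].
      right; ring. }
  apply ex_finite_lim_seq_incr with (M := / d).
  - intro n; rewrite sum_Sn.
    rewrite <- Rplus_0_r at 1.
    apply Rplus_le_compat_l, Rlt_le, exp_pos.
  - intro n; eapply Rle_trans; [apply bound|].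
    pose proof (exp_pos (- d * L (S n))).
    pose proof (Rinv_0_lt_compat d Hd); nra.
Qed.

Lemma ex_series_dirichlet (s : C) : 1 < Re s -> ex_series (dirichlet_term s).
Proof.
  intro Hs.
  apply (ex_series_le (V := C_CompleteNormedModule)) with
    (b := fun n => exp (- (1 + (Re s - 1)) * ln (INR (S n)))).
  - intro n.
    change (Cmod (dirichlet_term s n) <= exp (- (1 + (Re s - 1)) * ln (INR (S n)))).
    rewrite Cmod_dirichlet_term; right; f_equal; ring.
  - apply ex_series_inv_power; lra.
Qed.

(** * Termwise differentiation of the Dirichlet series *)

Lemma is_series_norm_le {K : AbsRing} {V : NormedModule K}
  (a : nat -> V) (b : nat -> R) (l : V) (m : R) :
  is_series a l -> is_series b m -> (forall n, norm (a n) <= b n) -> norm l <= m.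
Proof.
  intros Ha Hb Hab.
  apply (is_lim_seq_le (fun n => norm (sum_n a n)) (sum_n b) (norm l) m).
  - intro n; eapply Rle_trans; [apply norm_sum_n_m|].
    now apply sum_n_m_le.
  - apply (filterlim_comp _ _ _ (sum_n a) norm eventually (locally l) (locally (norm l)));
      [exact Ha | apply filterlim_norm].
  - exact Hb.
Qed.

(** Used with [x = ln n]: a logarithmic factor costs only a power [n^d]. *)
Lemma mul_exp_bound (d x : R) : 0 < d -> 0 <= x -> x <= / d * exp (d * x).
Proof.
  intros Hd Hx.
  pose proof (exp_ineq1_le (d * x)).
  apply Rmult_le_reg_l with d; [easy|].
  rewrite <- Rmult_assoc, Rinv_r; lra.
Qed.

Definition dirichlet_term_deriv (s : C) (n : nat) : C :=
  (- RtoC (ln (INR (S n))) * dirichlet_term s n)%C.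

Lemma ex_series_dirichlet_deriv (s : C) :
  1 < Re s -> ex_series (dirichlet_term_deriv s).
Proof.
  (* Here [Re s = 1 + 2 * d]: the logarithm consumes one [d], and the exponent [1 + d] that is left
     is still summable. *)
  intro Hs; set (d := (Re s - 1) / 2).
  assert (Hd : 0 < d) by (unfold d; lra).
  apply (ex_series_le (V := C_CompleteNormedModule)) with
    (b := fun n => scal (/ d) (exp (- (1 + d) * ln (INR (S n))))).
  - intro n.
    change (Cmod (dirichlet_term_deriv s n) <= / d * exp (- (1 + d) * ln (INR (S n)))).
    unfold dirichlet_term_deriv.
    pose proof (ln_INR_S_nonneg n) as HL.
    rewrite Cmod_mult, Cmod_opp, Cmod_R, Rabs_pos_eq, Cmod_dirichlet_term by easy.
    set (L := ln (INR (S n))) in *.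
    replace (- (1 + d) * L) with (d * L + - Re s * L) by (unfold d; field).
    rewrite exp_plus, <- Rmult_assoc.
    apply Rmult_le_compat_r; [left; apply exp_pos|].
    now apply mul_exp_bound.
  - apply (ex_series_scal (V := R_NormedModule)), ex_series_inv_power, Hd.
Qed.

(* The two powers of [ln n] in the quadratic Taylor remainder, and the factor
   [n^|w - z|], each cost [n^d]. *)
Lemma dirichlet_term_taylor (d : R) (z w : C) (n : nat) :
  0 < d -> Cmod (w - z) <= d ->
  Cmod (dirichlet_term w n - dirichlet_term z n
        - (w - z) * dirichlet_term_deriv z n)
  <= 5 * Cmod (w - z) ^ 2 * (/ d) ^ 2 * exp (- (Re z - 3 * d) * ln (INR (S n))).
Proof.
  intros Hd Hw; unfold dirichlet_term_deriv.
  pose proof (ln_INR_S_nonneg n) as HL.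
  pose proof (Cmod_dirichlet_term z n) as Hz.
  pose proof (dirichlet_term_Cexp z n) as Ez.
  rewrite (dirichlet_term_Cexp w n).
  set (L := ln (INR (S n))) in *.
  set (T := dirichlet_term z n) in *.
  set (h := (w - z)%C) in *.
  (* [dirichlet_term w n] equals [T * Cexp u], so the remainder is [T] times the Taylor remainder of
     [Cexp] at 0. *)
  set (u := (- (h * RtoC L))%C).
  replace (- (w * RtoC L))%C with (- (z * RtoC L) + u)%C by (unfold u, h; ring).
  rewrite Cexp_plus, <- Ez.
  replace (T * Cexp u - T - h * (- RtoC L * T))%C
    with (T * (Cexp u - 1 - u))%C by (unfold u; ring).
  rewrite Cmod_mult, Hz.
  assert (Hu : Cmod u = Cmod h * L)
    by (unfold u; rewrite Cmod_opp, Cmod_mult, Cmod_R, Rabs_pos_eq; easy).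
  pose proof (Cexp_taylor1_bound u) as HT; rewrite Hu in HT.
  pose proof (Cmod_ge_0 h) as Hh.
  assert (E1 : exp (Cmod h * L) <= exp (d * L)).
  { destruct (Req_dec (Cmod h * L) (d * L)) as [-> | Hne]; [lra|].
    left; apply exp_increasing; nra. }
  assert (E2 : L ^ 2 <= (/ d * exp (d * L)) ^ 2)
    by (apply pow_incr; split; [easy | now apply mul_exp_bound]).
  replace (- (Re z - 3 * d) * L) with (- Re z * L + (d * L + (d * L + d * L))) by ring.
  rewrite !exp_plus.
  set (e := exp (d * L)) in *.
  replace (5 * Cmod h ^ 2 * (/ d) ^ 2 * (exp (- Re z * L) * (e * (e * e))))
    with (exp (- Re z * L) * (5 * (Cmod h ^ 2 * (/ d * e) ^ 2) * e)) by ring.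
  apply Rmult_le_compat_l; [left; apply exp_pos|].
  eapply Rle_trans; [apply HT|].
  rewrite Rpow_mult_distr.
  pose proof (pow2_ge_0 (Cmod h)); pose proof (pow2_ge_0 L).
  apply Rmult_le_compat; [nra | left; apply exp_pos | nra | easy].
Qed.

(** The derivative is the sum [l] of the termwise derivatives: summing the termwise remainders
    leaves an error quadratic in [w - z]. *)
Lemma ex_derive_dirichlet (f : C -> C) (z : C) :
  (forall w, half_plane w -> is_series (dirichlet_term w) (f w)) ->
  half_plane z -> ex_derive f z.
Proof.
  unfold half_plane; intros Hf Hz.
  (* With a quarter of the gap, the disc of radius [d] stays in the half-plane and the exponent
     [Re z - 3 * d] of the remainder bound equals [1 + d]. *)
  set (d := (Re z - 1) / 4).
  assert (Hd : 0 < d) by (unfold d; lra).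
  destruct (ex_series_dirichlet_deriv z Hz) as [l Hl].
  destruct (ex_series_inv_power d Hd) as [M HM].
  set (A := 5 * (/ d) ^ 2 * M).
  assert (bound : forall w, Cmod (w - z) <= d ->
      Cmod (f w - f z - (w - z) * l) <= A * Cmod (w - z) ^ 2).
  { intros w Hw.
    assert (Hw1 : 1 < Re w).
    { pose proof (re_le_Cmod (w - z)) as H.
      change (Re (w - z)) with (Re w - Re z) in H.
      pose proof (Rle_trans _ _ _ H Hw) as Hd'.
      apply Rabs_le_between in Hd'; unfold d in Hd'; lra. }
    pose proof (is_series_minus _ _ _ _
      (is_series_minus _ _ _ _ (Hf w Hw1) (Hf z Hz))
      (is_series_scal (w - z)%C _ _ Hl)) as HS.
    pose proof (is_series_scal (V := R_NormedModule)
      (5 * Cmod (w - z) ^ 2 * (/ d) ^ 2) _ _ HM) as HB.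
    replace (A * Cmod (w - z) ^ 2)
      with (5 * Cmod (w - z) ^ 2 * (/ d) ^ 2 * M) by (unfold A; ring).
    apply (is_series_norm_le _ _ _ _ HS HB).
    intro n.
    pose proof (dirichlet_term_taylor d z w n Hd Hw) as H.
    replace (Re z - 3 * d) with (1 + d) in H by (unfold d; field).
    exact H. }
  exists l; split; [apply is_linear_scal_l|].
  intros x Hx.
  apply (is_filter_lim_locally_unique (V := AbsRing_NormedModule C_AbsRing)) in Hx.
  subst x.
  intro eps.
  (* A positive upper bound of [A]; the quadratic error is then at most [eps * Cmod (w - z)] once
     [Cmod (w - z) <= eps / B]. *)
  set (B := Rabs A + 1).
  assert (HB : 0 < B) by (unfold B; pose proof (Rabs_pos A); lra).
  assert (Hr : 0 < Rmin d (eps / B)).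
  { apply Rmin_pos; [easy|]. apply Rdiv_lt_0_compat; [apply cond_pos | easy]. }
  exists (mkposreal _ Hr); intros w Hw.
  change (Cmod (w - z) < Rmin d (eps / B)) in Hw.
  change (Cmod (f w - f z - (w - z) * l) <= eps * Cmod (w - z)).
  pose proof (Rmin_l d (eps / B)); pose proof (Rmin_r d (eps / B)).
  eapply Rle_trans; [apply bound; lra|].
  pose proof (Cmod_ge_0 (w - z)).
  assert (Cmod (w - z) * B <= eps).
  { apply Rmult_le_reg_r with (/ B); [now apply Rinv_0_lt_compat|].
    rewrite Rmult_assoc, Rinv_r, Rmult_1_r by lra; unfold Rdiv in *; lra. }
  assert (A <= B) by (unfold B; pose proof (Rle_abs A); lra).
  replace (A * Cmod (w - z) ^ 2) with (A * Cmod (w - z) * Cmod (w - z)) by ring.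
  apply Rmult_le_compat_r; [easy|]; nra.
Qed.

(** * The value of [zeta] on the half-plane of convergence *)

Lemma open_half_plane : open half_plane.
Proof.
  intros z Hz; unfold half_plane in *.
  assert (Hr : 0 < Re z - 1) by lra.
  exists (mkposreal _ Hr); intros w [Hw _].
  unfold ball, AbsRing_ball, abs, minus, plus, opp in Hw; simpl in Hw.
  change (Rabs (Re w - Re z) < Re z - 1) in Hw.
  apply Rabs_lt_between in Hw; lra.
Qed.

Lemma path_connected_half_plane : path_connected half_plane.
Proof.
  intros a b Ha Hb; unfold half_plane in *.
  (* The straight segment from [a] to [b]; it stays inside because the half-plane is convex. *)
  exists (fun t => ((1 - t) * Re a + t * Re b, (1 - t) * Im a + t * Im b)).
  repeat split.
  - intro t; apply filterlim_locally; intro eps.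
    apply filter_and;
      [ apply (proj1 (filterlim_locally (fun t => (1 - t) * Re a + t * Re b) _))
      | apply (proj1 (filterlim_locally (fun t => (1 - t) * Im a + t * Im b) _)) ];
      apply (ex_derive_continuous (V := R_NormedModule)); auto_derive; easy.
  - destruct a; simpl; f_equal; ring.
  - destruct b; simpl; f_equal; ring.
  - intros t Ht; change (1 < (1 - t) * Re a + t * Re b).
    destruct (Rle_lt_dec (Re a) (Re b)); nra.
Qed.

(** A continuation must exist before [epsilon] says anything: the half-plane itself with the sum of
    the series is one. Whichever continuation is then chosen agrees with the series at [s], since
    [s] lies in the half-plane. *)
Lemma is_series_zeta (s : C) :
  1 < Re s -> is_series (dirichlet_term s) (zeta s).
Proof.
  intro Hs.
  assert (Hex : exists v, is_zeta_value s v).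
  { set (f := fun z => epsilon (inhabits (RtoC 0)) (is_series (dirichlet_term z))).
    assert (Hf : forall z, half_plane z -> is_series (dirichlet_term z) (f z)).
    { intros z Hz; apply epsilon_spec, (ex_series_dirichlet z Hz). }
    exists (f s), half_plane, f.
    repeat split; try easy.
    - exact open_half_plane.
    - exact path_connected_half_plane.
    - intros z Hz; now apply ex_derive_dirichlet. }
  destruct (epsilon_spec (inhabits (RtoC 0)) (is_zeta_value s) Hex)
    as (U & f & _ & _ & _ & _ & _ & Hf & E).
  unfold zeta; rewrite <- E; now apply Hf.
Qed.

(** * Catalan quotients and the shift of index *)

Lemma catalan_ratio (n : nat) :
  catalan (S n) / central_binom (S n) = / INR (S (S n)).
Proof.
  unfold catalan; replace (S n + 1)%nat with (S (S n)) by lia.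
  assert (central_binom (S n) <> 0).
  { unfold central_binom, Binomial.C, Rdiv.
    apply Rmult_integral_contrapositive_currified; [apply INR_fact_neq_0|].
    apply Rinv_neq_0_compat, Rmult_integral_contrapositive_currified;
      apply INR_fact_neq_0. }
  field; split; [apply not_0_INR; lia | easy].
Qed.

(** Both are the power [- s] of [n + 2]: the base on the left is [1 / (n + 2)], and inverting a
    positive base negates its logarithm. *)
Lemma catalan_term_dirichlet (s : C) (n : nat) :
  catalan_term s n = dirichlet_term s (S n).
Proof.
  rewrite dirichlet_term_Cexp.
  unfold catalan_term, Rcpow.
  rewrite catalan_ratio, ln_Rinv by (apply lt_0_INR; lia).
  f_equal; rewrite RtoC_opp; ring.
Qed.

Lemma Rcpow_1 (s : C) : Rcpow 1 s = RtoC 1.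
Proof.
  unfold Rcpow; now rewrite ln_1, Cmult_0_r, Cexp_0.
Qed.

(** Splitting off the leading term, which is 1 on both sides, leaves the same series. Phrasing this
    for an arbitrary [l] covers convergence as well as the sum. *)
Lemma is_series_dirichlet_catalan (s l : C) :
  is_series (dirichlet_term s) l <->
  exists t : C,
    is_series (catalan_term s) t /\ l = (Rcpow (catalan 0 / 1) s + t)%C.
Proof.
  assert (E0 : Rcpow (catalan 0 / 1) s = dirichlet_term s 0).
  { unfold dirichlet_term; simpl.
    rewrite Rdiv_1_r, Rcpow_1; field; apply C1_nz. }
  rewrite E0; split.
  - intro H; exists (l - dirichlet_term s 0)%C; split; [|ring].
    apply (is_series_ext (fun n => dirichlet_term s (S n)));
      [intro n; symmetry; apply catalan_term_dirichlet|].
    apply is_series_incr_1.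
    replace (plus _ _) with l; [easy|].
    change (l = (l - dirichlet_term s 0 + dirichlet_term s 0)%C); ring.
  - intros [t [H ->]].
    apply is_series_decr_1.
    replace (plus _ _) with t;
      [| change (t = (dirichlet_term s 0 + t - dirichlet_term s 0)%C); ring].
    now apply (is_series_ext (catalan_term s)); [apply catalan_term_dirichlet|].
Qed.

(** The two series are compared at every [s], through convergence and sum together; they are
    identified with [zeta] on [Re s > 1], where the Dirichlet series converges. *)
Theorem proposition1 (s : C) :
  (forall l : C,
     is_series (dirichlet_term s) l <->
     exists t : C,
       is_series (catalan_term s) t /\
       l = (Rcpow (catalan 0 / 1) s + t)%C) /\
  (1 < Re s ->
     is_series (dirichlet_term s) (zeta s) /\
     exists t : C,
       is_series (catalan_term s) t /\
       zeta s = (Rcpow (catalan 0 / 1) s + t)%C).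
Proof.
  split; [intro l; apply is_series_dirichlet_catalan|].
  intro Hs; pose proof (is_series_zeta s Hs) as H.
  split; [exact H|].
  now apply is_series_dirichlet_catalan.
Qed.
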